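(* Let $g$ be a power series with $g(0)\equiv1\pmod 2$. The Riordan graph $G=G_n(g,tg)$ is io-decomposable if and only if $g^2\equiv g'$, i.e. $[t^j]g\equiv[t^{2j+1}]g$ for all $j\ge0$.
   Context: Power series are in the variable $t$ with coefficients in $\mathbb{Z}$ (or $\mathbb{Z}_2$); $\equiv$ means congruence mod $2$ (coefficientwise for power series); $'$ is the formal derivative; $[t^k]u$ is the coefficient of $t^k$ in $u$. For power series $g,f$ with $f(0)=0$, the Riordan graph $G_n(g,f)$ is the simple graph on the vertex set $\{1,\dots,n\}$ in which, for $i>j\ge1$, the vertices $i$ and $j$ are adjacent if and only if $[t^{i-2}]\,g f^{\,j-1}\equiv 1$. It is proper if the matrix of the coefficients $[t^i]gf^j$ mod $2$, $0\le i,j\le n-2$, is a proper (i.e. invertible) binary Riordan matrix, which means $g(0)\equiv f'(0)\equiv1$. A proper Riordan graph $G_n(g,f)$, with odd vertex set $V_o$ and even vertex set $V_e$, is io-decomposable if the induced subgraph $\langle V_o\rangle$ is isomorphic (as a graph) to $G_{\lceil n/2\rceil}(g,f)$ and the induced subgraph $\langle V_e\rangle$ is a null graph (no edges).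
   Formalization: The condition ''G_n(g,tg) is io-decomposable'' is taken for all n ≥ 1 at once; for a single fixed n the ''only if'' direction fails (for g = 1, n = 1 the graph is io-decomposable but g² = 1 is not congruent to g' = 0). *)

(* Defs.v *)
From mathcomp Require Import all_boot all_order all_algebra.

Set Implicit Arguments.
Unset Strict Implicit.
Unset Printing Implicit Defensive.

Import GRing.Theory.
Local Open Scope ring_scope.

(* The power series u is represented by its coefficients: u k = [t^k] u. *)
Definition series := nat -> int.

Definition ps_one : series := fun k => (k == 0%N)%:R.
Definition ps_t : series := fun k => (k == 1%N)%:R.
Definition ps_mul (u v : series) : series :=
  fun k => \sum_(i < k.+1) u i * v (k - i)%N.
Definition ps_exp (u : series) (m : nat) : series := iter m (ps_mul u) ps_one.
Definition ps_deriv (u : series) : series := fun k => u k.+1 *+ k.+1.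

Definition ps_congr2 (u v : series) : Prop :=
  forall k, (u k = v k %[mod 2])%Z.

Record sgraph := SGraph {
  vertex :> finType;
  adj : rel vertex;
  adj_sym : symmetric adj;
  adj_irr : irreflexive adj }.

Definition graph_iso (G H : sgraph) : Prop :=
  exists h : G -> H, bijective h /\ forall x y, adj (h x) (h y) = adj x y.

Definition null_graph (G : sgraph) : Prop := forall x y : G, ~~ adj x y.

Section Induced.
Variables (G : sgraph) (A : {set G}).

Definition induced_adj : rel {x : G | x \in A} :=
  fun x y => adj (val x) (val y).

Lemma induced_adj_sym : symmetric induced_adj.
Proof. by move=> x y; exact: adj_sym. Qed.

Lemma induced_adj_irr : irreflexive induced_adj.
Proof. by move=> x; exact: adj_irr. Qed.

Definition induced : sgraph := SGraph induced_adj_sym induced_adj_irr.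

End Induced.

(* The vertex set {1, ..., n} is encoded by 'I_n = {0, ..., n - 1}. *)
Definition label (n : nat) (x : 'I_n) : nat := x.+1.

Section RiordanGraph.
Variables (n : nat) (g f : series).

(* For labels i > j >= 1 we have i >= 2, so i - 2 is not truncated. *)
Definition riordan_edge (i j : nat) : bool :=
  (j < i)%N && (ps_mul g (ps_exp f (j - 1)) (i - 2)%N == 1 %[mod 2])%Z.

Definition riordan_adj : rel 'I_n :=
  fun x y => riordan_edge (label x) (label y)
             || riordan_edge (label y) (label x).

Lemma riordan_adj_sym : symmetric riordan_adj.
Proof. by move=> x y; rewrite /riordan_adj orbC. Qed.

Lemma riordan_adj_irr : irreflexive riordan_adj.
Proof. by move=> x; rewrite /riordan_adj /riordan_edge ltnn. Qed.

Definition riordan_graph : sgraph := SGraph riordan_adj_sym riordan_adj_irr.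

Definition odd_vertices : {set riordan_graph} :=
  [set x : 'I_n | odd (label x)].

Definition even_vertices : {set riordan_graph} :=
  [set x : 'I_n | ~~ odd (label x)].

End RiordanGraph.

(* f(0) = 0 is the condition under which Riordan graphs of (g, f) are
   considered at all; the two congruences express properness. *)
Definition riordan_proper (g f : series) : Prop :=
  [/\ f 0%N = 0, (g 0%N = 1 %[mod 2])%Z & (ps_deriv f 0%N = 1 %[mod 2])%Z].

(* uphalf n is the ceiling of n / 2. *)
Definition io_decomposable (n : nat) (g f : series) : Prop :=
  [/\ riordan_proper g f,
      graph_iso (induced (odd_vertices n g f)) (riordan_graph (uphalf n) g f)
    & null_graph (induced (even_vertices n g f))].

(* Main.v *)
Require Import Defs.
From mathcomp Require Import all_boot all_order all_algebra.
From mathcomp Require Import zify.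

(** Modulo 2 the entries that define G_n(g, tg) are coefficients of powers of
    g: labels i > j >= 1 are adjacent iff [t^(i-j-1)] g^j = 1 (lemma
    [riordan_edgeE]).  Squaring over F_2 is the substitution t |-> t^2, so
    even powers of g have no odd coefficients, which makes the even vertices
    independent.  For the odd vertices, let h be the series of
    odd coefficients of g, h_j = g_(2j+1).  Pulling squares out of
    g^(2b+1) = g (g^b)^2 shows that the adjacency of the labels 2a+1 > 2b+1 is
    read off [t^(a-b-1)] h g^b, whereas that of a+1 > b+1 is read off
    [t^(a-b-1)] g g^b.  Comparing the coefficients of g^2 and g' shows that
    g^2 = g' means exactly h = g, and in that case x |-> 2x (counting vertices
    from 0) is the required isomorphism.

    For the converse the isomorphism is arbitrary, so an invariant is needed,
    and the number of edges suffices.  Let j be the first index at which h and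
    g differ, and take n = 2j + 3, so that both graphs have j + 2 vertices.
    The differences a - b - 1 smaller than j give equal entries, and the only
    pair with a - b - 1 = j is (j + 1, 0), whose entries are h_j and g_j.
    Hence the two graphs differ in exactly one edge and cannot be isomorphic. *)

Set Implicit Arguments.
Unset Strict Implicit.
Unset Printing Implicit Defensive.

Import GRing.Theory.
Local Open Scope ring_scope.

(** * Squares of polynomials over the field with two elements *)

Lemma F2_sqr (c : 'F_2) : c ^+ 2 = c.
Proof. by case: c => [[|[|?]] ?] //; apply/val_inj. Qed.

(** The Frobenius map of F_2[t] is additive and fixes the coefficients. *)
Lemma sqr_polyF2 (p : {poly 'F_2}) : p ^+ 2 = p \Po 'X^2.
Proof.
have pchar2 : 2%N \in [pchar {poly 'F_2}] by rewrite pchar_poly pchar_Fp.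
elim/poly_ind: p => [|p c IHp]; first by rewrite comp_poly0 expr0n.
rewrite -(pFrobenius_autE pchar2) pFrobenius_autD_comm; last exact: mulrC.
rewrite !pFrobenius_autE exprMn IHp -polyC_exp F2_sqr.
by rewrite comp_polyD comp_polyM comp_polyX comp_polyC.
Qed.

Lemma coef_sqrF2 (p : {poly 'F_2}) k :
  (p ^+ 2)`_k = if odd k then 0 else p`_(k./2).
Proof.
by rewrite sqr_polyF2 coef_comp_poly_Xn // dvdn2 divn2; case: (odd k).
Qed.

(** Over F_2 a square only involves even powers, so it factors out of the odd
    part and is halved there. *)
Lemma odd_polyM_sqr (p q : {poly 'F_2}) :
  odd_poly (p * q ^+ 2) = odd_poly p * q.
Proof.
have evenX2 (r : {poly 'F_2}) : even_poly (r \Po 'X^2) = r.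
  apply/polyP=> i; rewrite coef_even_poly coef_comp_poly_Xn //.
  by rewrite dvdn2 odd_double divn2 doubleK.
have oddX2 (r : {poly 'F_2}) : odd_poly (r \Po 'X^2) = 0.
  apply/polyP=> i; rewrite coef_odd_poly coef_comp_poly_Xn //.
  by rewrite dvdn2 /= odd_double coef0.
rewrite sqr_polyF2 -{1}(poly_even_odd p) mulrDl mulrAC -!comp_polyM.
by rewrite odd_polyD odd_polyMX oddX2 evenX2 add0r.
Qed.

Lemma eq_coef_mulr (R : nzRingType) (p q r : {poly R}) m :
  (forall i, (i <= m)%N -> p`_i = q`_i) -> (p * r)`_m = (q * r)`_m.
Proof.
by move=> pq; rewrite !coefM; apply: eq_bigr => i _; rewrite pq // -ltnS.
Qed.

(** * Power series modulo 2 and their truncations *)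

Lemma eqz_mod2_F2 (a b : int) :
  (a == b %[mod 2])%Z = (a%:~R == b%:~R :> 'F_2).
Proof.
rewrite eqz_mod_dvd (dvdz_pcharf (pchar_Fp (isT : prime 2))).
by rewrite rmorphB subr_eq0.
Qed.

Lemma eqz_mod2P (a b : int) :
  (a = b %[mod 2])%Z <-> a%:~R = b%:~R :> 'F_2.
Proof. by split=> /eqP ab; apply/eqP; move: ab; rewrite eqz_mod2_F2. Qed.

(** Truncating makes the ring of polynomials available; all coefficients below
    the bound N are computed correctly. *)
Definition trunc2 (N : nat) (u : series) : {poly 'F_2} :=
  \poly_(i < N) (u i)%:~R.

Lemma coef_trunc2 N u k : (k < N)%N -> (trunc2 N u)`_k = (u k)%:~R.
Proof. by move=> kN; rewrite coef_poly kN. Qed.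

Lemma ps_mul_trunc2 N u v (p q : {poly 'F_2}) :
    (forall k, (k < N)%N -> (u k)%:~R = p`_k) ->
    (forall k, (k < N)%N -> (v k)%:~R = q`_k) ->
  forall k, (k < N)%N -> (ps_mul u v k)%:~R = (p * q)`_k.
Proof.
move=> up vq k kN; rewrite coefM rmorph_sum; apply: eq_bigr => i _ /=.
by rewrite rmorphM /= up ?vq //; have := ltn_ord i; lia.
Qed.

Lemma ps_exp_trunc2 N u (p : {poly 'F_2}) m :
    (forall k, (k < N)%N -> (u k)%:~R = p`_k) ->
  forall k, (k < N)%N -> (ps_exp u m k)%:~R = (p ^+ m)`_k.
Proof.
move=> up; elim: m => [|m IHm] k kN.
  by rewrite expr0 coef1 /ps_exp /= /ps_one; case: (k == 0%N).
by rewrite exprS; exact: (ps_mul_trunc2 up IHm).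
Qed.

Lemma ps_t_mul_trunc2 N u k :
  (k < N)%N -> (ps_mul ps_t u k)%:~R = ('X * trunc2 N u)`_k.
Proof.
apply: ps_mul_trunc2 => {}k kN; last by rewrite coef_trunc2.
by rewrite coefX /ps_t; case: (k == 1%N).
Qed.

(** * The condition on the coefficients *)

Lemma ps_sqr2 u k :
  (ps_exp u 2 k)%:~R = (if odd k then 0 else (u k./2)%:~R) :> 'F_2.
Proof.
rewrite (@ps_exp_trunc2 k.+1 u (trunc2 k.+1 u)) // => [|i ik]; last first.
  by rewrite coef_trunc2.
by rewrite coef_sqrF2 coef_trunc2 //; lia.
Qed.

Lemma ps_deriv2 u k :
  (ps_deriv u k)%:~R = (if odd k then 0 else (u k.+1)%:~R) :> 'F_2.
Proof.
rewrite /ps_deriv rmorphMn /= -mulr_natr.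
have -> : k.+1%:R = (~~ odd k)%:R :> 'F_2.
  by apply/val_inj; rewrite /= !val_Fp_nat //= !modn2 /= oddb.
by case: (odd k); rewrite ?mulr0 ?mulr1.
Qed.

(** Both sides vanish in odd degrees; in degree 2j they are g_j and
    g_(2j+1). *)
Lemma sqr_congr_derivE g :
  ps_congr2 (ps_exp g 2) (ps_deriv g)
    <-> forall j : nat, (g j = g (2 * j + 1)%N %[mod 2])%Z.
Proof.
split=> [sqr_g j | g_odd k].
  have /eqz_mod2P := sqr_g j.*2; rewrite ps_sqr2 ps_deriv2 odd_double doubleK.
  by move/eqz_mod2P; rewrite addn1 mul2n.
apply/eqz_mod2P; rewrite ps_sqr2 ps_deriv2; case: ifP => // k_even.
apply/eqz_mod2P; rewrite g_odd addn1 mul2n halfK k_even.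
by rewrite subn0.
Qed.

(** * Adjacency in the graphs of (g, tg) *)

(** The factor t^(j-1) of (tg)^(j-1) only shifts the coefficients, which leaves
    the j-th power of g. *)
Lemma riordan_edgeE N g i j : (0 < j)%N -> (i <= N)%N ->
  riordan_edge g (ps_mul ps_t g) i j =
  (j < i)%N && ((trunc2 N g ^+ j)`_(i - j - 1)%N == 1).
Proof.
case: j => // j _ iN; rewrite /riordan_edge; case: ltnP => //= ji.
rewrite eqz_mod2_F2 subn1 /=.
have -> : (ps_mul g (ps_exp (ps_mul ps_t g) j) (i - 2)%N)%:~R
          = (trunc2 N g * ('X * trunc2 N g) ^+ j)`_(i - 2)%N.
  apply: (@ps_mul_trunc2 N) => [k kN|k kN|]; last by lia.
    by rewrite coef_trunc2.
  by apply: (@ps_exp_trunc2 N) => // l; apply: ps_t_mul_trunc2.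
rewrite exprMn mulrCA -exprS coefXnM ltnNge.
have -> : (j <= i - 2)%N by lia.
by have -> : (i - 2 - j = i - j.+1 - 1)%N by lia.
Qed.

(** An entry between even labels is an odd coefficient of an even power of g,
    hence of a square. *)
Lemma even_riordan_edge g i j : (0 < j)%N -> ~~ odd i -> ~~ odd j ->
  ~~ riordan_edge g (ps_mul ps_t g) i j.
Proof.
move=> j_gt0 i_even j_even; rewrite (@riordan_edgeE i) //.
case: ltnP => //= ji.
rewrite -(even_halfK j_even) -muln2 exprM coef_sqrF2.
rewrite muln2 even_halfK //.
by have -> : odd (i - j - 1) by lia.
Qed.

(** Halving the odd labels replaces one factor g by its odd part. *)
Lemma odd_riordan_edgeE N g a b : (a.*2.+1 <= N)%N ->
  riordan_edge g (ps_mul ps_t g) a.*2.+1 b.*2.+1 =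
  (b < a)%N && ((odd_poly (trunc2 N g) * trunc2 N g ^+ b)`_(a - b - 1)%N == 1).
Proof.
move=> aN; rewrite (riordan_edgeE g (N := N)) // ltnS ltn_double.
case: ltnP => //= ba; rewrite -odd_polyM_sqr coef_odd_poly -exprM muln2 -exprS.
by congr (_`__ == 1); lia.
Qed.

Lemma riordan_edgeSE N g a b : (a < N)%N ->
  riordan_edge g (ps_mul ps_t g) a.+1 b.+1 =
  (b < a)%N && ((trunc2 N g * trunc2 N g ^+ b)`_(a - b - 1)%N == 1).
Proof.
by move=> aN; rewrite (riordan_edgeE g (N := N)) // ltnS subSS exprS.
Qed.

Lemma coef_odd_trunc2 N g i : (i.*2.+1 < N)%N ->
  (odd_poly (trunc2 N g))`_i = (g (2 * i + 1)%N)%:~R.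
Proof.
by move=> iN; rewrite coef_odd_poly coef_trunc2 // addn1 mul2n.
Qed.

(** The entry of the pair a > b depends on g and on its odd part only through
    their first a - b coefficients. *)
Lemma odd_riordan_edge_eq g a b :
    (forall i, (i < a - b)%N -> (g i = g (2 * i + 1)%N %[mod 2])%Z) ->
  riordan_edge g (ps_mul ps_t g) a.*2.+1 b.*2.+1
    = riordan_edge g (ps_mul ps_t g) a.+1 b.+1.
Proof.
move=> g_odd; rewrite (@odd_riordan_edgeE a.*2.+1) //.
rewrite (@riordan_edgeSE a.*2.+1); last by lia.
case: ltnP => //= ba.
congr (_ == 1); apply: eq_coef_mulr => i iab.
rewrite coef_odd_trunc2 ?coef_trunc2; try lia.
by apply/eqz_mod2P; rewrite -g_odd //; lia.
Qed.

(** For b = 0 no power of g is left, and the two entries at distance j + 1 are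
    the j-th coefficients of the odd part of g and of g.  They lie in F_2, so
    if they differ, one of them is 1 and the other is 0. *)
Lemma odd_riordan_edge_neq g j :
    (g j <> g (2 * j + 1)%N %[mod 2])%Z ->
  riordan_edge g (ps_mul ps_t g) j.+1.*2.+1 1
    = ~~ riordan_edge g (ps_mul ps_t g) j.+2 1.
Proof.
move=> neq_g; pose N := j.+1.*2.+1.
rewrite (@odd_riordan_edgeE N g j.+1 0) // (@riordan_edgeSE N g j.+1 0).
  rewrite !ltn0Sn subn0 subn1 /= expr0 !mulr1.
  rewrite coef_odd_trunc2 ?coef_trunc2 /N; try lia.
  move/eqP: neq_g; rewrite eqz_mod2_F2.
  by move: (_%:~R) (_%:~R) => [[|[|?]] ?] [[|[|?]] ?].
by rewrite /N; lia.
Qed.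

(** * Graphs that differ in one edge *)

Definition arcs (T : finType) (r : rel T) : {set T * T} :=
  [set p | r p.1 p.2].

Lemma card_arcs_bij (T U : finType) (r : rel T) (s : rel U) (h : T -> U) :
  bijective h -> (forall x y, s (h x) (h y) = r x y) ->
  #|arcs r| = #|arcs s|.
Proof.
move=> bij_h rs; have [h' hK h'K] := bij_h.
pose hh (p : T * T) := (h p.1, h p.2).
have inj_hh : injective hh.
  by move=> [x y] [x' y'] [/(bij_inj bij_h)-> /(bij_inj bij_h)->].
rewrite -(card_imset _ inj_hh); apply/eq_card=> -[u v].
apply/imsetP/idP => [[[x y]] | uv].
  by rewrite !inE /= => rxy [-> ->]; rewrite rs.
exists (h' u, h' v); last by rewrite /hh /= !h'K.
by move: uv; rewrite !inE /= -rs !h'K.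
Qed.

Lemma card_arcs_sub (T : finType) (r s : rel T) x0 y0 :
  subrel r s -> s x0 y0 -> ~~ r x0 y0 -> (#|arcs r| < #|arcs s|)%N.
Proof.
move=> rs sxy rxy; apply/proper_card/properP; split.
  by apply/subsetP=> p; rewrite !inE; apply: rs.
by exists (x0, y0); rewrite inE.
Qed.

(** Flipping one edge makes one of the two sets of arcs a proper subset of the
    other. *)
Lemma card_arcs_flip (T : finType) (r s : rel T) x0 y0 :
    symmetric r -> symmetric s ->
    s x0 y0 = ~~ r x0 y0 ->
    (forall x y, (x, y) != (x0, y0) -> (x, y) != (y0, x0) -> s x y = r x y) ->
  #|arcs r| <> #|arcs s|.
Proof.
move=> sym_r sym_s flip same.
have sub (r' s' : rel T) : symmetric r' -> symmetric s' ->
    s' x0 y0 -> ~~ r' x0 y0 ->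
    (forall x y, (x, y) != (x0, y0) -> (x, y) != (y0, x0) ->
       s' x y = r' x y) -> (#|arcs r'| < #|arcs s'|)%N.
  move=> sym_r' sym_s' s'xy r'xy same'.
  apply: (card_arcs_sub (x0 := x0) (y0 := y0)) => // x y rxy.
  have [[-> ->] //|ne1] := (x, y) =P (x0, y0).
  have [[-> ->] |ne2] := (x, y) =P (y0, x0); first by rewrite sym_s'.
  by rewrite same' //; apply/eqP.
have [rxy | rxy] := boolP (r x0 y0).
  apply/nesym/eqP; rewrite neq_ltn sub // => [|x y ne1 ne2].
    by rewrite flip rxy.
  by rewrite same.
by apply/eqP; rewrite neq_ltn sub // flip.
Qed.

(** * The induced subgraph on the odd vertices *)

Lemma double_ord_subproof n (x : 'I_(uphalf n)) : (x.*2 < n)%N.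
Proof. by have := ltn_ord x; lia. Qed.

Definition double_ord n (x : 'I_(uphalf n)) : 'I_n :=
  Ordinal (double_ord_subproof x).

Lemma odd_vertex_subproof n g f (x : 'I_(uphalf n)) :
  double_ord x \in odd_vertices n g f.
Proof. by rewrite inE /label /= odd_double. Qed.

Definition odd_vertex n g f (x : 'I_(uphalf n)) :
  induced (odd_vertices n g f) :=
  exist _ (double_ord x) (odd_vertex_subproof g f x).

Lemma odd_vertex_bij n g f : bijective (@odd_vertex n g f).
Proof.
have half_lt (y : induced (odd_vertices n g f)) :
    ((val y : 'I_n)./2 < uphalf n)%N.
  by have := ltn_ord (val y : 'I_n); lia.
exists (fun y => Ordinal (half_lt y)) => [x | y].
  by apply/val_inj; rewrite /= doubleK.
apply/val_inj/val_inj; rewrite /= even_halfK //.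
by have := valP y; rewrite inE /label.
Qed.

(** The induced graph carried back to 'I_(uphalf n), so that its arcs can be
    compared with those of the smaller Riordan graph vertex by vertex. *)
Definition halved_adj n g f : rel 'I_(uphalf n) :=
  fun x y => adj (odd_vertex g f x) (odd_vertex g f y).

Lemma halved_adjE n g f (x y : 'I_(uphalf n)) :
  halved_adj g f x y
    = riordan_edge g f x.*2.+1 y.*2.+1 || riordan_edge g f y.*2.+1 x.*2.+1.
Proof. by []. Qed.

Lemma riordan_proper_tg g :
  (g 0%N = 1 %[mod 2])%Z -> riordan_proper g (ps_mul ps_t g).
Proof.
move=> hg; split=> //; first by rewrite /ps_mul big_ord1 mul0r.
by rewrite /ps_deriv /ps_mul !big_ord_recr big_ord0 /= mul0r !add0r mul1r.
Qed.

Lemma io_decomposable_tg g n :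
    (g 0%N = 1 %[mod 2])%Z ->
    (forall j : nat, (g j = g (2 * j + 1)%N %[mod 2])%Z) ->
  io_decomposable n g (ps_mul ps_t g).
Proof.
move=> hg g_odd; split; first exact: riordan_proper_tg.
- have [h hK h'K] := odd_vertex_bij n g (ps_mul ps_t g).
  exists h; split; first by exists (@odd_vertex n g (ps_mul ps_t g)).
  move=> u v; rewrite -{2}(h'K u) -{2}(h'K v).
  rewrite -[RHS]/(halved_adj _ _ _ _) halved_adjE.
  by rewrite !odd_riordan_edge_eq.
move=> x y; have := valP x; have := valP y; rewrite !inE => y_even x_even.
rewrite /= /induced_adj /= /riordan_adj negb_or.
by rewrite !even_riordan_edge.
Qed.

(** If j is the least failing index, the graph with j + 2 odd vertices has one
    edge more or less than the Riordan graph on j + 2 vertices. *)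
Lemma io_decomposable_coef g :
    (forall n : nat, (0 < n)%N -> io_decomposable n g (ps_mul ps_t g)) ->
  forall j : nat, (g j = g (2 * j + 1)%N %[mod 2])%Z.
Proof.
move=> iog; elim/ltn_ind=> j IHj; apply/eqP/negPn/negP => /eqP neq_g.
set f := ps_mul ps_t g in iog; pose n := j.+1.*2.+1.
have [_ [h [bij_h adj_h]] _] := iog n isT.
have sizeE : uphalf n = j.+2 by rewrite /n /= doubleK.
have lt0 : (0 < uphalf n)%N by rewrite sizeE.
have ltj : (j.+1 < uphalf n)%N by rewrite sizeE.
pose x0 := Ordinal ltj; pose y0 := Ordinal lt0.
have sym_halved : symmetric (@halved_adj n g f) by move=> x y; apply: adj_sym.
have same_card : #|arcs (@riordan_adj (uphalf n) g f)|
                 = #|arcs (@halved_adj n g f)|.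
  apply/esym/(card_arcs_bij (bij_comp bij_h (odd_vertex_bij n g f))).
  by move=> x y /=; rewrite -[LHS]/(adj (_ : riordan_graph _ _ _) _) adj_h.
have edge0 i : riordan_edge g f 1 i.+1 = false by rewrite /riordan_edge ltnS.
apply: (@card_arcs_flip _ _ _ x0 y0) same_card => //.
- exact: riordan_adj_sym.
- rewrite halved_adjE /riordan_adj /label /= !edge0 !orbF.
  exact: odd_riordan_edge_neq.
(* Apart from the extreme pair (j + 1, 0), two of the j + 2 vertices are at
   distance at most j, where only coefficients below j enter. *)
have half_edge (x y : 'I_(uphalf n)) : (x, y) != (x0, y0) ->
    riordan_edge g f x.*2.+1 y.*2.+1 = riordan_edge g f x.+1 y.+1.
  move=> ne_xy; apply: odd_riordan_edge_eq => i ixy; apply: IHj.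
  have := ltn_ord x; rewrite {2}sizeE => xj.
  have [//|ji] := ltnP i j; case/negP: ne_xy.
  apply/eqP; congr (_, _); apply/val_inj;
    by move: ixy xj ji; clear; move=> /=; lia.
move=> x y ne1 ne2; rewrite halved_adjE /riordan_adj /label.
rewrite !half_edge //; apply: contraNneq ne2 => -[-> ->].
by [].
Qed.

Theorem lemma4p4 (g : series) (hg : (g 0%N = 1 %[mod 2])%Z) :
  ((forall n : nat, (0 < n)%N -> io_decomposable n g (ps_mul ps_t g))
     <-> ps_congr2 (ps_exp g 2) (ps_deriv g))
  /\
  (ps_congr2 (ps_exp g 2) (ps_deriv g)
     <-> forall j : nat, (g j = g (2 * j + 1)%N %[mod 2])%Z).
Proof.
split; last exact: sqr_congr_derivE.
split=> [iog | /sqr_congr_derivE g_odd n _].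
  by apply/sqr_congr_derivE/io_decomposable_coef.
exact: io_decomposable_tg.
Qed.
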